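(* Let $R$ be a unital ring and let $a,b,c\in R$ be such that $cab$ is regular. Let $x=b(cab)^-c$, where $(cab)^-$ is an arbitrary inner inverse of $cab$. Then the following are equivalent: (1) $x$ is the $(b,c)$-inverse of $a$; (2) $xax=x$, $bR\subseteq xR$ and $x^{\circ}\subseteq c^{\circ}$; (3) $b^{\circ}=(cab)^{\circ}$ and $cR=cabR$.
   Context: For $x\in R$: $xR=\{xr\mid r\in R\}$, $x^{\circ}=\{r\in R\mid xr=0\}$. An element $w\in R$ is regular if there exists $z\in R$ with $wzw=w$; any such $z$ is called an inner inverse of $w$ and denoted $w^-$. For $a,b,c\in R$, an element $y\in R$ is the $(b,c)$-inverse of $a$ if $y\in (bRy)\cap (yRc)$, $yab=b$ and $cay=c$, where $bRy=\{bry\mid r\in R\}$ and $yRc=\{yrc\mid r\in R\}$; such $y$ is unique if it exists. *)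

(* Defs.v *)
From mathcomp Require Import all_boot all_algebra.
From mathcomp Require Import classical_sets.

Set Implicit Arguments.
Unset Strict Implicit.
Unset Printing Implicit Defensive.

Import GRing.Theory.
Local Open Scope classical_set_scope.
Local Open Scope ring_scope.

(* Unital rings are [pzRingType]: associative, with 1, not assumed
   commutative, and with 1 = 0 allowed. *)

Definition right_ideal_of (R : pzRingType) (x : R) : set R :=
  [set x * r | r in [set: R]].

Definition right_annihilator (R : pzRingType) (x : R) : set R :=
  [set r | x * r = 0].

(* The set x R y. *)
Definition sandwich (R : pzRingType) (x y : R) : set R :=
  [set x * r * y | r in [set: R]].

Definition inner_inverse (R : pzRingType) (w z : R) : Prop := w * z * w = w.

(* Regularity in the sense of von Neumann, as opposed to [GRing.lreg] and
   [GRing.rreg], which express cancellability. *)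
Definition vn_regular (R : pzRingType) (w : R) : Prop :=
  exists z : R, inner_inverse w z.

Definition bc_inverse (R : pzRingType) (a b c y : R) : Prop :=
  [/\ (sandwich b y `&` sandwich y c) y, y * a * b = b & c * a * y = c].

(* Main.v *)
Require Import Defs.
From mathcomp Require Import all_boot all_algebra.
From mathcomp Require Import classical_sets.

Import GRing.Theory.
Local Open Scope classical_set_scope.
Local Open Scope ring_scope.

(** Write [d = c * a * b], so that [x = b * w * c] with [d * w * d = d]. All
    three conditions come down to the two equations [x * a * b = b] and
    [c * a * x = c], which for this [x] read [b * (w * d) = b] and
    [(d * w) * c = c]. Now [d * w] and [w * d] are idempotents: [d * w] acts as
    the identity on the left of [d R], and [1 - w * d] lies in the right
    annihilator of [d]. So the second equation says that [c] lies in [d R]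
    ([inner_inverse_mulKl]), and the first that the right annihilator of [d] is
    contained in that of [b] ([inner_inverse_mulKr]); the opposite inclusions in
    the third condition hold because [d] is a right multiple of [c] and a left
    multiple of [b]. The second condition encodes the same equations through the
    idempotents [x * a] and [a * x], that is, through [a] as an inner inverse
    of [x], so the same two lemmas apply to it. *)

Lemma mem_right_ideal_of (R : pzRingType) (x : R) : right_ideal_of x x.
Proof. by exists 1; rewrite ?mulr1. Qed.

Lemma right_ideal_ofM (R : pzRingType) (x r : R) :
  right_ideal_of (x * r) `<=` right_ideal_of x.
Proof. by move=> _ [s _ <-]; exists (r * s); rewrite ?mulrA. Qed.

Lemma right_annihilatorM (R : pzRingType) (r x : R) :
  right_annihilator x `<=` right_annihilator (r * x).
Proof.
by move=> s; rewrite /right_annihilator /= => xs0; rewrite -mulrA xs0 mulr0.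
Qed.

(** The idempotent [d * z] is a left identity on [d R]. *)
Lemma inner_inverse_mulKl (R : pzRingType) (d z y : R) :
  inner_inverse d z -> right_ideal_of d y -> d * z * y = y.
Proof. by move=> dzd [s _ <-]; rewrite mulrA dzd. Qed.

(** The element [1 - z * d] is annihilated by [d] on the left, hence by [y]. *)
Lemma inner_inverse_mulKr (R : pzRingType) (d z y : R) :
  inner_inverse d z -> right_annihilator d `<=` right_annihilator y ->
  y * z * d = y.
Proof.
move=> dzd /(_ (1 - z * d)); rewrite /right_annihilator /= !mulrBr !mulr1 !mulrA.
by rewrite dzd subrr => /(_ erefl)/eqP; rewrite subr_eq0 => /eqP.
Qed.

Theorem theorem3p5 (R : pzRingType) (a b c : R)
    (cab_regular : vn_regular (c * a * b))
    (w : R) (w_inner : inner_inverse (c * a * b) w)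
    (x : R) (x_def : x = b * w * c) :
  [<-> bc_inverse a b c x;
       [/\ x * a * x = x,
           right_ideal_of b `<=` right_ideal_of x
         & right_annihilator x `<=` right_annihilator c];
       right_annihilator b = right_annihilator (c * a * b) /\
       right_ideal_of c = right_ideal_of (c * a * b)].
Proof.
have xabE : x * a * b = b * w * (c * a * b) by rewrite x_def !mulrA.
have caxE : c * a * x = c * a * b * w * c by rewrite x_def !mulrA.
tfae.
- case=> -[[r _ xE] _] xab cax; split.
  + (* Here [x] lies in [b R], on which [x * a] is the identity. *)
    by rewrite -{2 3}xE !mulrA xab.
  + by rewrite -xab -mulrA; apply: right_ideal_ofM.
  + by rewrite -cax; apply: right_annihilatorM.
- move=> [xax bx xc].
  have xab : x * a * b = b.
    exact: inner_inverse_mulKl xax (bx _ (mem_right_ideal_of _ _)).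
  have cax : c * a * x = c := inner_inverse_mulKr _ _ _ _ xax xc.
  split; apply/seteqP; split.
  + exact: right_annihilatorM.
  + by rewrite -{2}xab xabE; apply: right_annihilatorM.
  + by rewrite -{1}cax caxE -[_ * w * c]mulrA; apply: right_ideal_ofM.
  + by rewrite -mulrA; apply: right_ideal_ofM.
- move=> [bd cd].
  have xab : x * a * b = b.
    by rewrite xabE; apply: inner_inverse_mulKr => //; rewrite bd.
  have cax : c * a * x = c.
    rewrite caxE; apply: inner_inverse_mulKl => //; rewrite -cd.
    exact: mem_right_ideal_of.
  split=> //; split.
  + (* [x = b * w * c], with the factor [c] rewritten as [c * a * x]. *)
    by exists (w * c * a) => //; rewrite [RHS]x_def -{2}cax !mulrA.
  + (* [x = b * w * c], with the factor [b] rewritten as [x * a * b]. *)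
    by exists (a * b * w) => //; rewrite [RHS]x_def -{2}xab !mulrA.
Qed.
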